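(* The query languages coMMSNP and MDDlog have the same expressive power.
   Context: **Queries.** A schema $\mathbf{S}$ is a finite set of relation symbols with arities. An instance $\mathfrak{D}$ over $\mathbf{S}$ is a finite set of facts $R(a_1,\dots,a_n)$, $R\in\mathbf{S}$, with $a_i$ from a fixed countably infinite set of constants; $\mathrm{adom}(\mathfrak{D})$ is the set of constants occurring in $\mathfrak{D}$. An $n$-ary query over $\mathbf{S}$ maps each $\mathbf{S}$-instance $\mathfrak{D}$ to a set $q(\mathfrak{D})\subseteq \mathrm{adom}(\mathfrak{D})^n$. Two queries over $\mathbf{S}$ are equivalent if they agree on all $\mathbf{S}$-instances. $\mathcal{Q}_2$ is at least as expressive as $\mathcal{Q}_1$ if every query of $\mathcal{Q}_1$ over some schema $\mathbf{S}$ is equivalent to a query of $\mathcal{Q}_2$ over $\mathbf{S}$; they have the same expressive power if this holds in both directions. **coMMSNP.** An MMSNP formula over $\mathbf{S}$ has the form $\exists X_1\cdots\exists X_n\forall x_1\cdots\forall x_m\,\varphi$ with $X_1,\dots,X_n$ monadic second-order variables, $x_1,\dots,x_m$ first-order variables, and $\varphi$ a conjunction of formulas $\alpha_1\wedge\cdots\wedge\alpha_k\to\beta_1\vee\cdots\vee\beta_l$ with $k,l\ge 0$, where each $\alpha_i$ is of the form $X_j(x)$, $R(\mathbf{x})$ with $R\in\mathbf{S}$, or $x=y$, and each $\beta_i$ is of the form $X_j(x)$. Free first-order variables are admitted; a formula without them is a sentence. An MMSNP formula $\Phi$ over $\mathbf{S}$ with $n$ free variables gives rise to the query $q_{\Phi,\mathbf{S}}(\mathfrak{D})=\{\mathbf{a}\in\mathrm{adom}(\mathfrak{D})^n\mid(\mathrm{adom}(\mathfrak{D}),\mathfrak{D})\not\models\Phi[\mathbf{a}]\}$,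 where $(\mathrm{adom}(\mathfrak{D}),\mathfrak{D})\models\Phi$ is set to true when $\mathfrak{D}$ is empty and $\Phi$ is a sentence. coMMSNP is the language of all such queries. **MDDlog.** A disjunctive datalog rule has the form $S_1(\mathbf{x}_1)\vee\cdots\vee S_m(\mathbf{x}_m)\leftarrow R_1(\mathbf{y}_1)\wedge\cdots\wedge R_n(\mathbf{y}_n)$, $m\ge 0$, $n>0$, where every head variable occurs in the body (empty head: $\bot$). A disjunctive datalog (DDlog) program $\Pi$ is a finite set of such rules with a selected predicate $\mathsf{goal}$ that does not occur in rule bodies and occurs in heads only in rules $\mathsf{goal}(\mathbf{x})\leftarrow R_1(\mathbf{x}_1)\wedge\cdots\wedge R_n(\mathbf{x}_n)$. Relation symbols occurring in some rule head are IDB predicates, the others EDB predicates. $\Pi$ defines the query $q_\Pi$ over the schema of its EDB predicates: $q_\Pi(\mathfrak{D})$ is the set of $\mathbf{a}\in\mathrm{adom}(\mathfrak{D})^n$ ($n$ the arity of $\mathsf{goal}$) with $\mathsf{goal}(\mathbf{a})\in\mathfrak{D}'$ for all instances $\mathfrak{D}'\supseteq\mathfrak{D}$ over the IDB and EDB predicates satisfying all rules of $\Pi$. $\Pi$ is an MDDlog program if all IDB predicates except possibly $\mathsf{goal}$ are unary. MDDlog denotes the language of all queries defined by MDDlog programs.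
   Formalization: Schema relation symbols are assumed to have positive arity (goal may be nullary); with nullary data relations the claim fails, e.g. goal() ← R(), goal() ← P(x), goal() ← P(x)∧T(x) over {R/0, P/1, T/1}, since on {R()} the domain is empty but the instance is not. *)

(* Defs.v *)
From Stdlib Require List.
From mathcomp Require Import all_boot finmap.

Set Implicit Arguments.
Unset Strict Implicit.
Unset Printing Implicit Defensive.

Local Open Scope fset_scope.

Definition const := nat.

(** A relation symbol is a name paired with its arity. *)
Definition relsym : Type := (nat * nat)%type.
Definition arity (R : relsym) : nat := R.2.

Definition atom (V : Type) : Type := {R : relsym & (arity R).-tuple V}.

Definition mk_atom (V : Type) (R : relsym) (t : (arity R).-tuple V) : atom V :=
  existT (fun R => (arity R).-tuple V) R t.
Definition symb (V : Type) (A : atom V) : relsym := projT1 A.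
Definition args (V : Type) (A : atom V) : seq V := projT2 A.
Definition atom_map (V W : Type) (h : V -> W) (A : atom V) : atom W :=
  mk_atom (map_tuple h (projT2 A)).

Definition fact : Type := atom const.

(** Data relations have positive arity, so that only the empty instance has an
    empty active domain. Nullary symbols are still available as [goal]
    predicates of programs, which are not part of a schema. *)
Record schema := Schema {
  symbols :> {fset relsym};
  schema_arity : {in symbols, forall R, 0 < arity R}
}.

(** The parameter is a plain set of symbols, because models of a program also
    interpret its (possibly nullary) goal predicate. *)
Record instance (P : {fset relsym}) := Instance {
  facts :> {fset fact};
  facts_over : {in facts, forall A : fact, symb A \in P}
}.

Definition adom (D : {fset fact}) : {fset const} :=
  [fset c in flatten [seq args A | A : fact <- D]].

Record query (S : schema) (n : nat) := Query {
  answer :> instance S -> n.-tuple const -> Prop;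
  answer_adom : forall D a, answer D a -> {subset a <= adom D}
}.

Definition equivalent (S : schema) (n : nat) (q1 q2 : query S n) : Prop :=
  forall (D : instance S) (a : n.-tuple const), q1 D a <-> q2 D a.

Definition query_language := forall (S : schema) (n : nat), query S n -> Prop.

Definition at_least_as_expressive (L2 L1 : query_language) : Prop :=
  forall (S : schema) (n : nat) (q1 : query S n), L1 S n q1 ->
    exists2 q2 : query S n, L2 S n q2 & equivalent q1 q2.

Definition same_expressive_power (L1 L2 : query_language) : Prop :=
  at_least_as_expressive L1 L2 /\ at_least_as_expressive L2 L1.

(** [p] is the number of second-order variables, [V] the type of first-order
    variables. *)
Inductive mmsnp_atom (p : nat) (V : Type) :=
  | MonAtom of 'I_p & V
  | RelAtom of atom V
  | EqAtom of V & V.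

Record mmsnp_clause (p : nat) (V : Type) := MmsnpClause {
  premises : seq (mmsnp_atom p V);
  conclusions : seq ('I_p * V)
}.

Definition premise_over (S : {fset relsym}) p V (al : mmsnp_atom p V) : Prop :=
  if al is RelAtom A then symb A \in S else True.

(** A formula whose free first-order variables are listed as [inl 0], ...,
    [inl (n - 1)]; the universally quantified ones are the [inr i]. *)
Record mmsnp (S : schema) (n : nat) := Mmsnp {
  so_vars : nat;
  fo_vars : nat;
  matrix : seq (mmsnp_clause so_vars ('I_n + 'I_fo_vars));
  matrix_over : forall cl, List.In cl matrix ->
    forall al, List.In al (premises cl) -> premise_over S al
}.

Section MmsnpSemantics.
Variables (D : {fset fact}) (p : nat) (V : Type).
Variables (X : 'I_p -> {fset const}) (v : V -> const).

Definition holds_premise (al : mmsnp_atom p V) : Prop :=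
  match al with
  | MonAtom j x => v x \in X j
  | RelAtom A => atom_map v A \in D
  | EqAtom x y => v x = v y
  end.

Definition holds_clause (cl : mmsnp_clause p V) : Prop :=
  (forall al, List.In al (premises cl) -> holds_premise al) ->
  exists2 be, List.In be (conclusions cl) & v be.2 \in X be.1.
End MmsnpSemantics.

Definition mmsnp_sat (S : schema) (n : nat) (dom : {fset const})
    (D : {fset fact}) (Phi : mmsnp S n) (a : n.-tuple const) : Prop :=
  exists2 X : 'I_(so_vars Phi) -> {fset const}, (forall j, X j `<=` dom) &
  forall b : 'I_(fo_vars Phi) -> const, (forall i, b i \in dom) ->
  forall cl, List.In cl (matrix Phi) ->
    holds_clause D X
      (fun x => match x with inl i => tnth a i | inr i => b i end) cl.

(** By convention every sentence is true in the empty instance, even one whose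
    matrix fails without any variable being instantiated. *)
Definition mmsnp_true (S : schema) (n : nat) (D : {fset fact})
    (Phi : mmsnp S n) (a : n.-tuple const) : Prop :=
  (D = fset0 /\ n = 0) \/ mmsnp_sat (adom D) D Phi a.

Definition mmsnp_answer (S : schema) (n : nat) (Phi : mmsnp S n)
    (D : instance S) (a : n.-tuple const) : Prop :=
  {subset a <= adom D} /\ ~ mmsnp_true D Phi a.

Definition coMMSNP : query_language := fun S n q =>
  exists Phi : mmsnp S n, forall D a, q D a <-> mmsnp_answer Phi D a.

Definition var := nat.

(** A rule is a pair of a disjunctive head and a conjunctive body; an empty head
    stands for falsity. *)
Definition rule : Type := (seq (atom var) * seq (atom var))%type.
Definition head (r : rule) := r.1.
Definition body (r : rule) := r.2.

Definition vars (As : seq (atom var)) : seq var := flatten (map (@args var) As).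
Definition symbs (As : seq (atom var)) : seq relsym := map (@symb var) As.

Definition head_symbs (rs : seq rule) : {fset relsym} :=
  [fset R in flatten [seq symbs (head r) | r <- rs]].
Definition body_symbs (rs : seq rule) : {fset relsym} :=
  [fset R in flatten [seq symbs (body r) | r <- rs]].

Record ddlog (n : nat) := Ddlog {
  goal_name : nat;
  rules : seq rule;
  body_nonempty : {in rules, forall r, body r <> [::]};
  rule_safe : {in rules, forall r, {subset vars (head r) <= vars (body r)}};
  goal_body : (goal_name, n) \notin body_symbs rules;
  goal_head : {in rules, forall r,
    (goal_name, n) \in symbs (head r) -> size (head r) = 1}
}.

Definition goal n (Pi : ddlog n) : relsym := (goal_name Pi, n).

Definition idb n (Pi : ddlog n) : {fset relsym} := head_symbs (rules Pi).
Definition edb n (Pi : ddlog n) : {fset relsym} :=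
  body_symbs (rules Pi) `\` idb Pi.

Definition goal_fact n (Pi : ddlog n) (a : n.-tuple const) : fact :=
  @mk_atom const (goal Pi) a.

Definition satisfies_rule (D : {fset fact}) (r : rule) : Prop :=
  forall h : var -> const,
    {in body r, forall A, atom_map h A \in D} ->
    exists2 A, A \in head r & atom_map h A \in D.

Definition ddlog_answer n (Pi : ddlog n) (D : {fset fact})
    (a : n.-tuple const) : Prop :=
  {subset a <= adom D} /\
  forall D' : instance (idb Pi `|` edb Pi), D `<=` D' ->
    {in rules Pi, forall r, satisfies_rule D' r} ->
    goal_fact Pi a \in facts D'.

Definition monadic n (Pi : ddlog n) : Prop :=
  {in idb Pi, forall R, R <> goal Pi -> arity R = 1}.

Definition MDDlog : query_language := fun S n q =>
  exists Pi : ddlog n,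
    [/\ monadic Pi, edb Pi = symbols S &
        forall D a, q D a <-> ddlog_answer Pi D a].

(* Main.v *)
From Stdlib Require List.
From mathcomp Require Import all_boot finmap.
Require Import Defs.

(** From MDDlog to coMMSNP, the IDB predicates other than [goal] become the
    second-order variables, the rules without [goal] become clauses, and a rule
    with head [goal(x)] becomes a clause with an empty conclusion whose premises
    equate [x] with the free variables. Hence a tuple is not an answer iff some
    interpretation of the IDB predicates satisfies all clauses.

    From coMMSNP to MDDlog, a program guesses for every element of the active
    domain and every [X_j] whether [X_j] or its complement holds, and every
    clause becomes a rule deriving [goal] of the free variables when the clause
    is violated. A tuple is not an answer iff some guess avoids deriving [goal]
    for it; the guess may depend on the tuple, so a single program suffices. *)

Set Implicit Arguments.
Unset Strict Implicit.
Unset Printing Implicit Defensive.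

Local Open Scope fset_scope.

(** * Two notions of list membership: [List.In] for clauses, [\in] for rules and facts *)

Lemma In_mem (T : eqType) (x : T) (s : seq T) : List.In x s <-> x \in s.
Proof.
elim: s => [|y s IHs] /=; first by rewrite in_nil.
rewrite in_cons; split=> [[->|/IHs ->]|/orP[/eqP->|/IHs]]; rewrite ?eqxx ?orbT //.
  by left.
by right.
Qed.

Lemma mem_flatten_map (T : Type) (U : eqType) (f : T -> seq U) s (x : U) :
  x \in flatten [seq f y | y <- s] <-> exists2 y, List.In y s & x \in f y.
Proof.
elim: s => [|y s IHs] /=; first by split=> // -[].
rewrite mem_cat; split=> [/orP[fyx|/IHs[z sz fzx]]|[z [<-|sz] fzx]].
- by exists y; first left.
- by exists z; first right.
- by rewrite fzx.
- by apply/orP; right; apply/IHs; exists z.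
Qed.

Lemma all_In (T : Type) (P : pred T) s : all P s <-> forall x, List.In x s -> P x.
Proof.
elim: s => [|y s IHs] //=; split.
  by move=> /andP[Py /IHs Ps] x [<-|/Ps].
by move=> Ps; rewrite Ps /=; [apply/IHs => x sx; apply: Ps; right | left].
Qed.

(** * Atoms, their images under maps, and unary atoms *)

Section Atoms.
Variables V W : Type.

Lemma args_atom_map (h : V -> W) A : args (atom_map h A) = map h (args A).
Proof. by []. Qed.

Lemma atom_map_comp U (g : W -> U) (h : V -> W) A :
  atom_map g (atom_map h A) = atom_map (g \o h) A.
Proof.
case: A => R t; rewrite /atom_map /mk_atom /=; congr existT.
by apply: val_inj => /=; rewrite -map_comp.
Qed.

(* For a symbol of arity 1 this is the atom [R(x)]; repeating the argument
   avoids a cast along [arity R = 1]. *)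
Definition unary (R : relsym) (x : V) : atom V :=
  mk_atom (nseq_tuple (arity R) x).

Lemma args_unary (R : relsym) x : arity R = 1 -> args (unary R x) = [:: x].
Proof. by rewrite /args /= => ->. Qed.

Lemma unary_eta x0 (A : atom V) : arity (symb A) = 1 ->
  A = unary (symb A) (nth x0 (args A) 0).
Proof.
case: A => -[k m] t; rewrite /symb /arity /= => m1; subst m.
rewrite /unary /mk_atom; congr existT; apply: val_inj => /=.
by rewrite /args /=; case: t => -[|x []].
Qed.
End Atoms.

Lemma atom_map_unary V W (h : V -> W) R x :
  atom_map h (unary R x) = unary R (h x).
Proof.
rewrite /atom_map /unary /mk_atom /=; congr existT.
by apply: val_inj; rewrite /= map_nseq.
Qed.

Lemma eq_in_atom_map (V : eqType) W (f g : V -> W) (A : atom V) :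
  {in args A, f =1 g} -> atom_map f A = atom_map g A.
Proof.
case: A => R t fg; rewrite /atom_map /mk_atom /=; congr existT.
by apply: val_inj => /=; apply/eq_in_map => x /fg.
Qed.

(** * Active domains and nonempty instances *)

Lemma adomP (D : {fset fact}) c :
  reflect (exists2 A, A \in D & c \in args A) (c \in adom D).
Proof.
rewrite /adom in_fset /=.
by apply: (iffP flatten_mapP) => -[A]; exists A.
Qed.

(** A finite supply of facts, from which a predicate on facts can carve out an instance. *)
Definition all_facts (I : {fset relsym}) (dom : {fset const}) : seq fact :=
  flatten [seq [seq mk_atom (map_tuple val t) | t : (arity R).-tuple dom] | R <- I].

Lemma mem_all_facts I dom (A : fact) :
  (A \in all_facts I dom) = (symb A \in I) && all (mem dom) (args A).
Proof.
apply/flatten_mapP/andP.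
  move=> [R RI /mapP[t _ ->]]; split=> //.
  by apply/allP => c /mapP[x _ ->]; apply: valP.
case: A => R t [/= RI /allP dom_t]; exists R => //.
apply/mapP; exists [tuple [`dom_t _ (mem_tnth i t)] | i < arity R].
  by rewrite mem_enum.
congr existT; apply: eq_from_tnth => i.
by rewrite tnth_map tnth_mktuple.
Qed.

(** Schema symbols have positive arity, so any fact has a first argument. *)
Lemma adom_neq0 (S : schema) (D : instance S) :
  facts D <> fset0 -> exists c, c \in adom D.
Proof.
case: (fset_0Vmem D) => [-> //|[A DA] _].
have := schema_arity (facts_over DA).
case: A DA => R t DA /= R_gt0; exists (tnth t (Ordinal R_gt0)).
by apply/adomP; exists (existT _ R t) => //; rewrite /args mem_tnth.
Qed.

(** For [n = 0] the convention makes the formula true in the empty instance; for [n > 0] no tuple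
    lies in an empty active domain. *)
Lemma mmsnp_answer_neq0 (S : schema) n (Phi : mmsnp S n) (D : instance S) a :
  mmsnp_answer Phi D a -> facts D <> fset0.
Proof.
move=> [aD Phi_false] D0; apply: Phi_false; left; split=> //.
case: n a {Phi} aD => // n a /(_ _ (mem_tnth ord0 a)) /adomP[A].
by rewrite D0 in_fset0.
Qed.

(** * Disjunctive datalog programs and their countermodels *)

Section Ddlog.
Variables (n : nat) (Pi : ddlog n).

Lemma mem_idb r A : r \in rules Pi -> A \in head r -> symb A \in idb Pi.
Proof.
move=> rP rA; rewrite /idb /head_symbs in_fset; apply/flatten_mapP.
by exists r => //; apply: map_f.
Qed.

Lemma mem_body_symbs r A :
  r \in rules Pi -> A \in body r -> symb A \in body_symbs (rules Pi).
Proof.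
move=> rP rA; rewrite /body_symbs in_fset; apply/flatten_mapP.
by exists r => //; apply: map_f.
Qed.

Lemma body_neq_goal r A :
  r \in rules Pi -> A \in body r -> symb A != goal Pi.
Proof.
move=> rP rA; apply: contraTneq (mem_body_symbs rP rA) => ->; exact: goal_body.
Qed.

Lemma goal_notin_edb : goal Pi \notin edb Pi.
Proof. by rewrite in_fsetD negb_and goal_body orbT. Qed.

(** Rule bodies are nonempty, so no rule fires in the empty instance, which is thus a model without
    the goal fact. *)
Lemma ddlog_answer_neq0 (D : {fset fact}) a : ddlog_answer Pi D a -> D <> fset0.
Proof.
move=> [_ ansD] D0.
have over0 : {in fset0, forall A : fact, symb A \in idb Pi `|` edb Pi}.
  by move=> A; rewrite in_fset0.
have := ansD (Instance over0); rewrite D0 /= fsubset_refl in_fset0.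
move=> /(_ isT) fset0_not_model; suff: false by [].
apply: fset0_not_model => r rP h; have := body_nonempty rP.
case: (body r) => // A As _ /(_ A (mem_head _ _)); by rewrite in_fset0.
Qed.

(* The countermodel consists of [D] and the IDB facts over [adom D] in [M];
   by safety of the rules nothing else can be derived. *)
Lemma ddlog_no_answer (D : {fset fact}) a (M : pred fact) :
  {in D, forall A, symb A \in edb Pi} -> ~~ M (goal_fact Pi a) ->
  {in rules Pi, forall r (h : var -> const),
    {in vars (body r), forall x, h x \in adom D} ->
    {in body r, forall A,
      atom_map h A \in D \/ symb A \in idb Pi /\ M (atom_map h A)} ->
    exists2 A, A \in head r & M (atom_map h A)} ->
  ~ ddlog_answer Pi D a.
Proof.
move=> D_edb Mgoal Mrules [_ ansD].
pose D' := D `|` [fset A in [seq A <- all_facts (idb Pi) (adom D) | M A]].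
have D'E A : (A \in D') = (A \in D) ||
    [&& M A, symb A \in idb Pi & all (mem (adom D)) (args A)].
  by rewrite in_fsetU in_fset mem_filter mem_all_facts.
have D'over : {in D', forall A : fact, symb A \in idb Pi `|` edb Pi}.
  by move=> A; rewrite D'E in_fsetU => /orP[/D_edb->|/and3P[_ -> _]]; rewrite ?orbT.
have D'adom A : A \in D' -> {subset args A <= adom D}.
  by rewrite D'E => /orP[DA c Ac|/and3P[_ _ /allP //]]; apply/adomP; exists A.
suff D'model : {in rules Pi, forall r, satisfies_rule D' r}.
  have := ansD (Instance D'over) (fsubsetUl _ _) D'model.
  rewrite /= D'E (negPf Mgoal) orbF => /D_edb.
  by rewrite (negPf goal_notin_edb).
move=> r rP h D'body.
have h_adom : {in vars (body r), forall x, h x \in adom D}.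
  move=> x /flatten_mapP[A rA Ax]; apply: (D'adom _ (D'body _ rA)).
  by rewrite args_atom_map map_f.
have [|A rA MA] := Mrules r rP h h_adom.
  move=> A rA; have := D'body A rA; rewrite D'E => /orP[|/and3P[]]; by [left|right].
exists A => //; rewrite D'E MA (mem_idb rP rA) /= orbC.
apply/orP; left; apply/allP => c; rewrite args_atom_map => /mapP[x Ax ->].
by apply/h_adom/(rule_safe rP)/flatten_mapP; exists A.
Qed.
End Ddlog.

(** * From MDDlog to coMMSNP *)

Section MddlogToMmsnp.
Variables (S : schema) (n : nat) (Pi : ddlog n).
Hypotheses (Pi_monadic : monadic Pi) (Pi_edb : edb Pi = symbols S).

Let I := enum_fset (idb Pi).
(** The successors in [p] and [m] provide the inhabited ordinals that [inord] requires. Every body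
    variable is below [m], so [inord] merges no two of them. *)
Let p := (size I).+1.
Let m := (\max_(x <- flatten [seq vars (body r) | r <- rules Pi]) x).+1.
Let V : Type := ('I_n + 'I_m)%type.

Definition fo_var (x : var) : V := inr (inord x).
Definition so_var (R : relsym) : 'I_p := inord (index R I).
Definition arg0 (A : atom nat) : nat := nth 0 (args A) 0.

Definition body_premise (A : atom var) : mmsnp_atom p V :=
  if symb A \in idb Pi then MonAtom (so_var (symb A)) (fo_var (arg0 A))
  else RelAtom p (atom_map fo_var A).

(** Reading arguments by position avoids a cast to [n]-tuples; for a goal atom, which has [n]
    arguments, the default 0 is never reached. *)
Definition goal_premises (A : atom var) : seq (mmsnp_atom p V) :=
  [seq EqAtom p (inl i) (fo_var (nth 0 (args A) i)) | i : 'I_n].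

(** By [goal_head], a head containing the goal predicate is a single atom, so the flattened list
    consists of the equations for that atom alone. *)
Definition rule_clause (r : rule) : mmsnp_clause p V :=
  if goal Pi \in symbs (head r) then
    MmsnpClause (map body_premise (body r) ++ flatten (map goal_premises (head r)))
      [::]
  else
    MmsnpClause (map body_premise (body r))
      [seq (so_var (symb A), fo_var (arg0 A)) | A <- head r].

(** A body symbol that is not IDB is EDB, hence in [S]. *)
Lemma rule_clauses_over cl : List.In cl (map rule_clause (rules Pi)) ->
  forall al, List.In al (premises cl) -> premise_over S al.
Proof.
move=> /List.in_map_iff[r [<- /In_mem rP]] al.
have body_over : List.In al (map body_premise (body r)) -> premise_over S al.
  move=> /List.in_map_iff[A [<- /In_mem rA]]; rewrite /body_premise.
  case: ifPn => //= A_idb; rewrite -Pi_edb in_fsetD A_idb.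
  exact: mem_body_symbs rP rA.
rewrite /rule_clause; case: ifP => _ //= /List.in_app_iff[//|].
move=> /List.in_concat[ls [/List.in_map_iff[A [<- _]]]].
by move=> /List.in_map_iff[i [<- _]].
Qed.

Definition mddlog_mmsnp : mmsnp S n := Mmsnp rule_clauses_over.

Lemma so_varK R : R \in idb Pi -> nth (0, 0) I (so_var R) = R.
Proof. by move=> RI; rewrite inordK ?nth_index // ltnS index_size. Qed.

Lemma idb_unary (A : atom nat) : symb A \in idb Pi -> symb A != goal Pi ->
  A = unary (symb A) (arg0 A).
Proof. by move=> AI /eqP AG; apply: unary_eta; apply: Pi_monadic. Qed.

Lemma goal_atom_map (A : atom var) (h : var -> const) (a : n.-tuple const) :
  symb A = goal Pi -> (forall i : 'I_n, tnth a i = h (nth 0 (args A) i)) ->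
  atom_map h A = goal_fact Pi a.
Proof.
case: A => R t; rewrite /symb /= => RG; subst R => ha.
rewrite /goal_fact /atom_map; congr mk_atom; apply: eq_from_tnth => i.
by rewrite tnth_map ha (tnth_nth 0).
Qed.

(** By contraposition: a model of the program that omits the goal fact of [a] yields second-order
    values satisfying all clauses. *)
Lemma mddlog_mmsnp_sound (D : instance S) a :
  mmsnp_answer mddlog_mmsnp D a -> ddlog_answer Pi D a.
Proof.
move=> [aD Phi_false]; split=> // D' DD' D'model.
apply: contraT => D'goal; case: Phi_false; right.
(* [D'] may contain further constants; dropping them is harmless, as all first-order variables take
   values in [adom D]. *)
exists (fun j => [fset c in adom D | unary (nth (0, 0) I j) c \in facts D']).
  by move=> j; apply/fsubsetP => c; rewrite !inE => /andP[].
move=> b bD cl /List.in_map_iff[r [<- /In_mem rP]] /=.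
set v := fun x : V => _; set X := fun j : 'I_p => _.
have XE j c : (c \in X j) =
    (c \in adom D) && (unary (nth (0, 0) I j) c \in facts D') by rewrite !inE.
pose h x := v (fo_var x).
have hD x : h x \in adom D by apply: bD.
have body_D' : (forall al, List.In al (map body_premise (body r)) ->
    holds_premise D X v al) -> {in body r, forall A, atom_map h A \in facts D'}.
  move=> prem A rA.
  have := prem _ (List.in_map body_premise _ _ ((In_mem _ _).2 rA)).
  rewrite /body_premise; case: ifPn => A_idb /=.
    rewrite XE so_varK // => /andP[_].
    by rewrite [in atom_map h A](idb_unary A_idb (body_neq_goal rP rA)) atom_map_unary.
  by rewrite atom_map_comp => /(fsubsetP DD').
rewrite /rule_clause; case: ifPn => [Gr|Gr] prem.
  have [|A rA D'A] := D'model r rP h.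
    by apply: body_D' => al al_in; apply/prem/List.in_app_iff; left.
  have AG : symb A = goal Pi.
    move: Gr rA (goal_head rP Gr); case: (head r) => [|B []] //=.
    by rewrite !inE => /eqP-> /eqP->.
  (* The equations among the premises turn the derived head into the goal fact of [a]. *)
  case/negP: D'goal; rewrite -(goal_atom_map (h := h) AG) // => i.
  apply: (prem (EqAtom p (inl i) (fo_var (nth 0 (args A) i)))).
  apply/List.in_app_iff; right; apply/List.in_concat.
  exists (goal_premises A); split; first by apply/List.in_map/In_mem.
  by apply/List.in_map_iff; exists i; split=> //; apply/In_mem; rewrite mem_enum.
have [A rA D'A] := D'model r rP h (body_D' prem).
have A_idb := mem_idb rP rA.
have AG : symb A != goal Pi by apply: contraNneq Gr => <-; apply: map_f.
exists (so_var (symb A), fo_var (arg0 A)).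
  by apply/List.in_map_iff; exists A; split=> //; apply/In_mem.
rewrite XE so_varK //; apply/andP; split; first exact: hD.
by rewrite (idb_unary A_idb AG) atom_map_unary in D'A.
Qed.

(** By contraposition: second-order values satisfying all clauses yield a countermodel for [a]. *)
Lemma mddlog_mmsnp_complete (D : instance S) a :
  ddlog_answer Pi D a -> mmsnp_answer mddlog_mmsnp D a.
Proof.
move=> ansD; have [aD _] := ansD; split=> // -[[D0 _]|[X XD Xsat]].
  exact: ddlog_answer_neq0 ansD D0.
have [c0 c0D] := adom_neq0 (ddlog_answer_neq0 ansD).
pose M (A : fact) := if symb A == goal Pi then A != goal_fact Pi a
                     else arg0 A \in X (so_var (symb A)).
apply: (ddlog_no_answer (M := M)) ansD.
- by move=> A /facts_over; rewrite Pi_edb.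
- by rewrite /M ifT ?negbK //; apply: eqxx.
move=> r rP h hD bodyM.
(* Only variables of the rule body are known to have values in [adom D]; [c0] replaces stray values
   of the others. *)
pose b (i : 'I_m) := if h i \in adom D then h i else c0.
have bD i : b i \in adom D by rewrite /b; case: ifP.
have := Xsat b bD (rule_clause r) (List.in_map _ _ _ ((In_mem _ _).2 rP)).
set v := fun x : V => _.
have vh x : x \in vars (body r) -> v (fo_var x) = h x.
  move=> rx; rewrite /v /fo_var /b inordK ?hD // ltnS.
  by apply: leq_bigmax_seq => //; apply/flatten_mapP; exists r.
have va i : v (inl i) = tnth a i by [].
clearbody v; have vhA A : {subset args A <= vars (body r)} ->
    atom_map v (atom_map fo_var A) = atom_map h A.
  move=> Ar; rewrite atom_map_comp; apply: eq_in_atom_map => x /Ar; exact: vh.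
have body_vars A : A \in body r -> {subset args A <= vars (body r)}.
  by move=> rA x Ax; apply/flatten_mapP; exists A.
have head_vars A : A \in head r -> {subset args A <= vars (body r)}.
  by move=> rA x Ax; apply: (rule_safe rP); apply/flatten_mapP; exists A.
have arg0_in (A : atom var) : symb A \in idb Pi -> symb A != goal Pi ->
    arg0 A \in args A.
  move=> A_idb /eqP AG; rewrite mem_nth // /args size_tuple.
  by rewrite (Pi_monadic A_idb AG).
have arg0_map A : symb A \in idb Pi -> symb A != goal Pi ->
    arg0 (atom_map h A) = h (arg0 A).
  move=> A_idb AG; have := arg0_in A A_idb AG; rewrite /arg0 args_atom_map.
  by case: (args A).
have prem_body al : List.In al (map body_premise (body r)) -> holds_premise D X v al.
  move=> /List.in_map_iff[A [<- /In_mem rA]]; have AG := body_neq_goal rP rA.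
  rewrite /body_premise; case: ifPn => A_idb /=.
    case: (bodyM A rA) => [/facts_over|[_]].
      by rewrite -Pi_edb in_fsetD A_idb.
    rewrite /M (negPf AG) arg0_map // vh //.
    by apply/(body_vars _ rA)/arg0_in.
  rewrite vhA; last exact: body_vars.
  by case: (bodyM A rA) => // -[]; rewrite (negPf A_idb).
rewrite /rule_clause; case: ifPn => [Gr|Gr] clX.
  have [A rA AG] : exists2 A, A \in head r & goal Pi = symb A by apply/mapP.
  exists A => //; rewrite /M ifT; last by rewrite AG; apply: eqxx.
  (* If the head became the goal fact of [a], all premises including the equations would hold,
     against the empty conclusion. *)
  apply/negP => /eqP hA; have [|//] := clX.
  move=> al /List.in_app_iff[/prem_body //|/List.in_concat[ls []]].
  move=> /List.in_map_iff[B [<- /In_mem rB]] /List.in_map_iff[i [<- _]] /=.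
  have -> : B = A.
    move: rA rB (goal_head rP Gr); case: (head r) => [|C []] //=.
    by rewrite !inE => /eqP-> /eqP->.
  have sA : size (args A) = n by rewrite /args size_tuple -/(symb A) -AG.
  rewrite va vh; last by apply: (head_vars A rA); rewrite mem_nth ?sA.
  rewrite -(nth_map 0 0) ?sA // -args_atom_map hA.
  by rewrite (tnth_nth 0).
have [be /List.in_map_iff[A [<- /In_mem rA]] /= vX] := clX prem_body.
have A_idb := mem_idb rP rA.
have AG : symb A != goal Pi by apply: contraNneq Gr => <-; apply: map_f.
exists A => //; rewrite /M (negPf AG) arg0_map //.
rewrite -vh //; by apply/(head_vars _ rA)/arg0_in.
Qed.

End MddlogToMmsnp.

(** * From coMMSNP to MDDlog: construction of the program *)

Section MmsnpToMddlog.
Variables (S : schema) (n : nat) (Phi : mmsnp S n).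

Let p := so_vars Phi.
Let V : finType := ('I_n + 'I_(fo_vars Phi))%type.
Let K := #|V|.

Definition fresh_name : nat := (\max_(R <- enum_fset S) R.1).+1.

(* [Some (j, true)] labels the second-order variable [X_j], [Some (j, false)]
   its complement, and [None] the active domain. *)
Definition label : finType := option ('I_p * bool).
(** The successor keeps these symbols apart from the goal predicate, named [fresh_name], even when
    [n] is 1. *)
Definition pred_symb (t : label) : relsym := ((fresh_name + choice.pickle t).+1, 1).
Definition pred_atom (t : label) (x : var) : atom var := unary (pred_symb t) x.

(* Equalities are eliminated by identifying variables in all possible ways:
   there is one rule for each map [s] that respects them. *)
Let renaming : finType := {ffun V -> 'I_K.+1}.

Definition respects (s : renaming) (al : mmsnp_atom p V) : bool :=
  if al is EqAtom x y then s x == s y else true.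

Definition premise_atoms (s : renaming) (al : mmsnp_atom p V) : seq (atom var) :=
  match al with
  | MonAtom j x => [:: pred_atom (Some (j, true)) (s x)]
  | RelAtom A => [:: atom_map (fun x => s x : nat) A]
  | EqAtom _ _ => [::]
  end.

(** The body says that the clause is violated: conclusions enter as complements. The domain atoms
    confine all variables to the active domain, make the rule safe and keep its body nonempty. *)
Definition goal_rule (cl : mmsnp_clause p V) (s : renaming) : rule :=
  ([:: @mk_atom var (fresh_name, n) [tuple s (inl i) : nat | i < n]],
   [seq pred_atom None k | k <- iota 0 K.+1]
   ++ flatten [seq premise_atoms s al | al <- premises cl]
   ++ [seq pred_atom (Some (be.1, false)) (s be.2) | be <- conclusions cl]).

Definition clause_rules (cl : mmsnp_clause p V) : seq rule :=
  [seq goal_rule cl s | s <- enum renaming & all (respects s) (premises cl)].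

Definition adom_rules (R : relsym) : seq rule :=
  [seq ([:: pred_atom None i], [:: mk_atom (iota_tuple (arity R) 0)])
     | i <- iota 0 (arity R)].

Definition guess_rule (j : 'I_p) : rule :=
  ([:: pred_atom (Some (j, true)) 0; pred_atom (Some (j, false)) 0],
   [:: pred_atom None 0]).

(* The tautology makes the active domain predicate an IDB even if [S] is empty. *)
Definition domain_tautology : rule :=
  ([:: pred_atom None 0], [:: pred_atom None 0]).

Definition mmsnp_rules : seq rule :=
  domain_tautology :: flatten [seq adom_rules R | R <- enum_fset S]
  ++ [seq guess_rule j | j : 'I_p]
  ++ flatten [seq clause_rules cl | cl <- matrix Phi].

Variant mmsnp_rule_spec : rule -> Prop :=
  | DomainTautology : mmsnp_rule_spec domain_tautology
  | AdomRule R i : R \in symbols S -> i < arity R ->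
      mmsnp_rule_spec ([:: pred_atom None i], [:: mk_atom (iota_tuple (arity R) 0)])
  | GuessRule j : mmsnp_rule_spec (guess_rule j)
  | GoalRule cl s : List.In cl (matrix Phi) ->
      (forall al, List.In al (premises cl) -> respects s al) ->
      mmsnp_rule_spec (goal_rule cl s).

Lemma mmsnp_ruleP r : r \in mmsnp_rules <-> mmsnp_rule_spec r.
Proof.
rewrite in_cons !mem_cat; split.
  case/or4P => [/eqP->|/flatten_mapP[R RS /mapP[i i_lt ->]]|/mapP[j _ ->]|].
  - exact: DomainTautology.
  - by apply: AdomRule => //; rewrite mem_iota in i_lt.
  - exact: GuessRule.
  move=> /mem_flatten_map[cl clP /mapP[s]].
  by rewrite mem_filter => /andP[/all_In s_cl _] ->; apply: GoalRule.
case=> [|R i RS i_lt|j|cl s clP s_cl]; apply/or4P.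
- by constructor 1.
- constructor 2; apply/flatten_mapP; exists R => //.
  by apply/mapP; exists i; rewrite ?mem_iota.
- by constructor 3; apply: map_f; rewrite mem_enum.
- constructor 4; apply/mem_flatten_map; exists cl => //.
  apply: map_f; rewrite mem_filter mem_enum andbT; exact/all_In.
Qed.

(** * Freshness of the added symbols and well-formedness of the program *)

Lemma fresh_notin R : fresh_name <= R.1 -> R \notin symbols S.
Proof.
rewrite leqNgt; apply: contra => RS; rewrite ltnS.
exact: (leq_bigmax_seq (F := fun R : relsym => R.1) R RS isT).
Qed.

Lemma pred_symb_notin t : pred_symb t \notin symbols S.
Proof. by apply: fresh_notin; rewrite /= -addnS leq_addr. Qed.

Lemma goal_symb_notin : (fresh_name, n) \notin symbols S.
Proof. exact: fresh_notin. Qed.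

Lemma pred_symb_inj : injective pred_symb.
Proof. by move=> t u [/addnI/(pcan_inj choice.pickleK)]. Qed.

Lemma pred_symb_neq_goal t : pred_symb t != (fresh_name, n).
Proof. by rewrite xpair_eqE /= -addnS -[X in _ == X]addn0 eqn_add2l. Qed.

Lemma goal_rule_adom cl (s : renaming) x :
  pred_atom None (s x) \in body (goal_rule cl s).
Proof. by rewrite mem_cat map_f // mem_iota ltn_ord. Qed.

Lemma goal_rule_body cl s A : List.In cl (matrix Phi) ->
  A \in body (goal_rule cl s) ->
  symb A \in symbols S \/ exists t, symb A = pred_symb t.
Proof.
move=> clP; rewrite !mem_cat => /or3P[/mapP[k _ ->]| |/mapP[be _ ->]].
- by right; exists None.
- move=> /mem_flatten_map[al al_cl]; have := matrix_over clP al_cl.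
  case: al al_cl => [j x|B|//] _ /= BS; rewrite inE => /eqP->; last by left.
  by right; exists (Some (j, true)).
- by right; exists (Some (be.1, false)).
Qed.

Lemma mmsnp_body_symb r A : r \in mmsnp_rules -> A \in body r ->
  symb A \in symbols S \/ exists t, symb A = pred_symb t.
Proof.
move=> /mmsnp_ruleP[|R i RS _|j|cl s clP _]; last exact: goal_rule_body.
- by rewrite inE => /eqP->; right; exists None.
- by rewrite inE => /eqP->; left.
- by rewrite inE => /eqP->; right; exists None.
Qed.

Lemma mmsnp_body_nonempty : {in mmsnp_rules, forall r, body r <> [::]}.
Proof. by move=> r /mmsnp_ruleP[]. Qed.

Lemma args_pred_atom t x : args (pred_atom t x) = [:: x].
Proof. exact: args_unary. Qed.

Lemma mmsnp_rule_safe :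
  {in mmsnp_rules, forall r, {subset vars (head r) <= vars (body r)}}.
Proof.
move=> r /mmsnp_ruleP[|R i RS i_lt|j|cl s _ _] x; rewrite {1}/vars /= ?args_pred_atom //.
- by rewrite inE => /eqP->; rewrite /vars /= cats0 mem_iota.
- by rewrite !inE orbb.
rewrite cats0 => /tnthP[i ->]; rewrite tnth_mktuple.
apply/flatten_mapP; exists (pred_atom None (s (inl i))).
  exact: goal_rule_adom.
by rewrite args_pred_atom inE.
Qed.

Lemma mmsnp_goal_body : (fresh_name, n) \notin body_symbs mmsnp_rules.
Proof.
rewrite /body_symbs in_fset; apply/flatten_mapP => -[r rP /mapP[A rA AG]].
case: (mmsnp_body_symb rP rA) => [|[t]]; rewrite -AG.
  by rewrite (negPf goal_symb_notin).
by move/esym/eqP; rewrite (negPf (pred_symb_neq_goal t)).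
Qed.

Lemma mmsnp_goal_head : {in mmsnp_rules, forall r,
  (fresh_name, n) \in symbs (head r) -> size (head r) = 1}.
Proof.
move=> r /mmsnp_ruleP[||j|] //=; rewrite !inE /symb /= ![_ == pred_symb _]eq_sym.
by rewrite !(negPf (pred_symb_neq_goal _)).
Qed.

Definition mmsnp_mddlog : ddlog n := @Ddlog n fresh_name mmsnp_rules
  mmsnp_body_nonempty mmsnp_rule_safe mmsnp_goal_body mmsnp_goal_head.

Lemma pred_symb_idb t : pred_symb t \in idb mmsnp_mddlog.
Proof.
pose r := if t is Some (j, _) then guess_rule j else domain_tautology.
have rP : r \in mmsnp_rules.
  apply/mmsnp_ruleP; rewrite /r; case: t {r} => [[j b]|]; constructor.
apply: (@mem_idb _ mmsnp_mddlog r (pred_atom t 0) rP).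
by rewrite /r; case: t {r rP} => [[j []]|]; rewrite !inE eqxx ?orbT.
Qed.

Lemma mmsnp_head_symb R : R \in idb mmsnp_mddlog ->
  R = (fresh_name, n) \/ exists t, R = pred_symb t.
Proof.
rewrite /idb /head_symbs in_fset => /flatten_mapP[r /mmsnp_ruleP rP /mapP[A rA ->]].
case: rP rA => [|R' i _ _|j|cl s _ _]; rewrite !inE.
- by move/eqP->; right; exists None.
- by move/eqP->; right; exists None.
- by case/orP=> /eqP->; right; [exists (Some (j, true))|exists (Some (j, false))].
- by move/eqP->; left.
Qed.

Lemma mmsnp_mddlog_monadic : monadic mmsnp_mddlog.
Proof. by move=> R /mmsnp_head_symb[|[t ->]]. Qed.

(** Positive arity gives each symbol of [S] a position 0, so it occurs in the body of a domain rule;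
    the label symbols in bodies are all IDB. *)
Lemma mmsnp_mddlog_edb : edb mmsnp_mddlog = symbols S.
Proof.
apply/fsetP => R; rewrite in_fsetD; apply/andP/idP.
  move=> [R_idb]; rewrite /body_symbs in_fset => /flatten_mapP[r rP /mapP[A rA RA]].
  case: (mmsnp_body_symb rP rA); rewrite -RA // => -[t Rt].
  by rewrite Rt pred_symb_idb in R_idb.
move=> RS; split.
  apply/negP => /mmsnp_head_symb[RG|[t Rt]].
    by move: goal_symb_notin; rewrite -RG RS.
  by move: (pred_symb_notin t); rewrite -Rt RS.
rewrite /body_symbs in_fset; apply/flatten_mapP.
exists ([:: pred_atom None 0], [:: mk_atom (iota_tuple (arity R) 0)]).
  by apply/mmsnp_ruleP; apply: AdomRule => //; apply: schema_arity RS.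
by rewrite inE.
Qed.

(** * Correctness of the program *)

Lemma mmsnp_mddlog_complete (D : instance S) a :
  mmsnp_answer Phi D a -> ddlog_answer mmsnp_mddlog D a.
Proof.
move=> ansD; have [aD Phi_false] := ansD; split=> // D' DD' D'model.
have [c0 c0D] := adom_neq0 (mmsnp_answer_neq0 ansD).
apply: contraT => D'goal; case: Phi_false; right.
(* A model may carry both labels at one element. Reading off the positive one suffices: outside
   [X j] the guess rule forces the complement. *)
pose X (j : 'I_p) := [fset c in adom D | unary (pred_symb (Some (j, true))) c \in facts D'].
have XE j c : (c \in X j) =
    (c \in adom D) && (unary (pred_symb (Some (j, true))) c \in facts D').
  by rewrite !inE.
have D'rule r : mmsnp_rule_spec r -> satisfies_rule D' r.
  by move=> /mmsnp_ruleP; apply: D'model.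
have D'adom c : c \in adom D -> unary (pred_symb None) c \in facts D'.
  move=> /adomP[A DA /(nthP 0)[i i_lt <-]].
  have AS := facts_over DA; rewrite /args size_tuple in i_lt.
  (* The rule body has the variables 0, 1, ... in order, so this valuation maps it to [A]. *)
  have [|B] := D'rule _ (AdomRule AS i_lt) (nth 0 (args A)).
    move=> B; rewrite inE => /eqP->; apply: (fsubsetP DD').
    rewrite (_ : atom_map _ _ = A) //.
    case: A DA {AS i_lt} => R t _; rewrite /atom_map /mk_atom; congr existT.
    by apply: val_inj => /=; rewrite map_nth_iota0 ?size_tuple // take_oversize ?size_tuple.
  by rewrite inE => /eqP->; rewrite atom_map_unary.
exists X; first by move=> j; apply/fsubsetP => c; rewrite XE => /andP[].
move=> b bD cl clP prem.
set v := (fun x => _) in prem *.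
have vD x : v x \in adom D.
  by case: x => i; [apply/aD/mem_tnth | apply: bD].
have [/hasP[be /In_mem cl_be Xbe]|/hasPn no_concl] :=
  boolP (has (fun be => v be.2 \in X be.1) (conclusions cl)).
  by exists be.
case/negP: D'goal.
(* [s] sends a variable to the first position of its value in [vs], so it identifies variables with
   equal values and respects every equality that holds; [h] recovers the values. The surplus
   variable [K] gets the default [c0], which satisfies its domain atom. *)
pose vs := [seq v x | x <- enum V]; pose h := nth c0 vs.
have sz_vs : size vs = K by rewrite size_map -cardE.
pose s : renaming := [ffun x => inord (index (v x) vs)].
have sE x : s x = index (v x) vs :> nat.
  by rewrite ffunE inordK // ltnS -sz_vs index_size.
have hs x : h (s x) = v x by rewrite sE /h nth_index // map_f // mem_enum.
have hD k : h k \in adom D.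
  rewrite /h; have [k_lt|k_ge] := ltnP k (size vs); last by rewrite nth_default.
  by have /mapP[x _ ->] := mem_nth c0 k_lt.
have s_cl al : List.In al (premises cl) -> respects s al.
  by move=> /prem; case: al => //= x y vxy; apply/eqP/val_inj; rewrite /= !sE vxy.
have [|A] := D'rule _ (GoalRule clP s_cl) h.
  move=> A; rewrite !mem_cat => /or3P[/mapP[k _ ->]| |/mapP[be cl_be ->]].
  - by rewrite atom_map_unary D'adom.
  - move=> /mem_flatten_map[al /prem]; case: al => [j x|B|//] /=.
      by rewrite XE => /andP[_ D'x]; rewrite inE => /eqP->; rewrite atom_map_unary hs.
    move=> DB; rewrite inE => /eqP->; apply: (fsubsetP DD').
    by rewrite atom_map_comp (eq_in_atom_map (g := v)) // => x _; apply: hs.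
  - rewrite atom_map_unary hs.
    have [|B] := D'rule _ (GuessRule be.1) (fun=> v be.2).
      by move=> B; rewrite inE => /eqP->; rewrite atom_map_unary D'adom.
    rewrite !inE => /orP[] /eqP->; rewrite atom_map_unary //= => D'be.
    by have := no_concl be cl_be; rewrite XE vD D'be.
rewrite inE => /eqP->; rewrite (_ : atom_map _ _ = goal_fact mmsnp_mddlog a) //.
rewrite /atom_map /goal_fact; congr mk_atom; apply: eq_from_tnth => i.
by rewrite tnth_map tnth_mktuple hs.
Qed.

Lemma mmsnp_mddlog_sound (D : instance S) a :
  ddlog_answer mmsnp_mddlog D a -> mmsnp_answer Phi D a.
Proof.
move=> ansD; have [aD _] := ansD; split=> // -[[D0 _]|[X XD Xsat]].
  exact: ddlog_answer_neq0 ansD D0.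
(* The countermodel interprets the labels exactly by [X]. The domain label may be true everywhere,
   since only IDB facts over [adom D] are kept. *)
pose interp (t : label) c := if t is Some (j, b) then (c \in X j) == b else true.
pose M (A : fact) := if symb A == (fresh_name, n) then A != goal_fact mmsnp_mddlog a
  else [exists t, (symb A == pred_symb t) && interp t (nth 0 (args A) 0)].
have ME t c : M (unary (pred_symb t) c) = interp t c.
  rewrite /M (negPf (pred_symb_neq_goal t)); apply/existsP/idP.
    by move=> [u /andP[/eqP/pred_symb_inj <-]].
  by move=> t_c; exists t; rewrite eqxx.
apply: (ddlog_no_answer (M := M)) ansD.
- by move=> A /facts_over; rewrite mmsnp_mddlog_edb.
- by rewrite /M ifT ?negbK //; apply: eqxx.
move=> r rP h hD bodyM.
have body_pred t x : pred_atom t x \in body r -> interp t (h x).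
  move=> /bodyM; rewrite atom_map_unary ME => -[/facts_over|[//]].
  by rewrite -[symb _]/(pred_symb t) (negPf (pred_symb_notin t)).
have head_pred t x : pred_atom t x \in head r -> interp t (h x) ->
    exists2 A, A \in head r & M (atom_map h A).
  by move=> rA t_x; exists (pred_atom t x); rewrite // atom_map_unary ME.
move: rP => /mmsnp_ruleP rP; case: rP hD bodyM body_pred head_pred => /=.
- by move=> _ _ _ /(_ None 0); apply; rewrite // inE.
- by move=> R i _ _ _ _ _ /(_ None i); apply; rewrite // inE.
- move=> j _ _ _ head_pred; have [Xj|Xj] := boolP (h 0 \in X j).
    by apply: (head_pred (Some (j, true)) 0); rewrite ?inE ?eqxx /= ?Xj.
  by apply: (head_pred (Some (j, false)) 0); rewrite ?inE ?eqxx ?orbT //= (negPf Xj).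
move=> cl s clP s_cl hD bodyM body_pred _.
set A := mk_atom _; exists A; first by rewrite inE.
rewrite /M ifT; last exact: eqxx.
(* Suppose a goal rule derives the goal fact of [a]. Its clause, evaluated at [h] after [s], has
   true premises, hence a true conclusion, against the complement atom in the body. *)
apply/negP => /eqP hA.
have sD x : h (s x) \in adom D.
  apply: hD; apply/flatten_mapP; exists (pred_atom None (s x)).
    exact: goal_rule_adom.
  by rewrite args_pred_atom inE.
have := Xsat (fun j => h (s (inr j))) (fun j => sD _) cl clP.
set v := (fun x => _).
(* For the free variables this is the equality [hA] of the derived head with the goal fact of
   [a]. *)
have vE x : v x = h (s x).
  case: x => // i; rewrite /v (tnth_nth 0).
  rewrite -[a : seq _]/(args (goal_fact mmsnp_mddlog a)) -hA args_atom_map.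
  rewrite (nth_map 0); last by rewrite /args size_tuple.
  by rewrite -tnth_nth tnth_mktuple.
case=> [al al_cl|be /In_mem cl_be].
  have al_body B : B \in premise_atoms s al -> B \in body (goal_rule cl s).
    by move=> alB; rewrite !mem_cat; apply/or3P; constructor 2; apply/mem_flatten_map; exists al.
  have := s_cl al al_cl; case: al al_cl al_body => [j x|B|x y] al_cl al_body /=.
  - move=> _; rewrite vE; apply/eqP; apply: (body_pred (Some (j, true))).
    by apply: al_body; rewrite inE.
  - have /bodyM : atom_map (fun x => s x : nat) B \in body (goal_rule cl s).
      by apply: al_body; rewrite inE.
    rewrite atom_map_comp (eq_in_atom_map (g := v)); last by move=> x _; rewrite vE.
    (* A relational premise has its symbol in [S], which is not IDB, so its image must be a fact of
       [D]. *)
    case=> // -[/mmsnp_head_symb BS _ _]; have := matrix_over clP al_cl.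
    rewrite /= -[symb B]/(symb (atom_map (fun x => s x : nat) B)).
    case: BS => [->|[t ->]]; first by rewrite (negPf goal_symb_notin).
    by rewrite (negPf (pred_symb_notin t)).
  - by move/eqP; rewrite !vE => ->.
have /body_pred : pred_atom (Some (be.1, false)) (s be.2) \in body (goal_rule cl s).
  by rewrite !mem_cat; apply/or3P; constructor 3; apply/mapP; exists be.
by rewrite /= -vE => /eqP->.
Qed.

End MmsnpToMddlog.

Theorem proposition2 : same_expressive_power coMMSNP MDDlog.
Proof.
split=> S n q.
  (* Both languages are closed under equivalence, so [q] itself serves as the equivalent query. *)
  move=> [Pi [Pi_monadic Pi_edb qE]]; exists q => //.
  exists (mddlog_mmsnp Pi_edb) => D a; rewrite qE; split.
    exact: mddlog_mmsnp_complete.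
  exact: mddlog_mmsnp_sound.
move=> [Phi qE]; exists q => //; exists (mmsnp_mddlog Phi); split.
- exact: mmsnp_mddlog_monadic.
- exact: mmsnp_mddlog_edb.
move=> D a; rewrite qE; split.
  exact: mmsnp_mddlog_complete.
exact: mmsnp_mddlog_sound.
Qed.
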